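(* For every integer $d\ge 1$ there is a constant $K_d\in(0,\infty)$, depending only on $d$, such that the following holds. Let $n,k,t\ge 1$ be integers and let $\psi=(\psi_1,\dots,\psi_k):\mathbb{R}^n\to\mathbb{R}^k$ be a polynomial mapping such that each coordinate $\psi_i$ is a multilinear polynomial with coefficients in $\{0,1\}$, of degree at most $d$ and of multiplicity $t$. Then for any $r_1,\dots,r_d\ge 1$ such that $\sum_{i=1}^d\frac1{r_i}=1$ and any $p\in[1,2]$, $$\mathrm{GW}\big(\psi(\{0,1\}^n)\big)\le K_d\, n\,t\,T_p\big(\mathcal{L}^n_{r_1,\dots,r_d}\big)\,k^{1/p}.$$
   Context: The Gaussian width of a set $T\subseteq\mathbb{R}^k$ is $\mathrm{GW}(T)=\mathbb{E}\big[\sup_{x\in T}\langle x,g\rangle\big]$, where $g\sim N(0,I_k)$. A polynomial is multilinear if every variable has exponent $0$ or $1$ in each of its monomials. A polynomial has multiplicity $t$ if each of its variables has a nonzero exponent in at most $t$ monomials in its support. For a Banach space $X$ and $p>0$, the type-$p$ constant $T_p(X)$ is the smallest $T$ such that for every $k$ and all $x_1,\dots,x_k\in X$, $$\mathbb{E}_\varepsilon\Big\|\sum_{i=1}^k\varepsilon_ix_i\Big\|_X^p\le T^p\sum_{i=1}^k\|x_i\|_X^p,$$ the expectation being over a uniformly random $\varepsilon=(\varepsilon_1,\dots,\varepsilon_k)\in\{-1,1\}^k$. (Finite-dimensional spaces have $T_p(X)<\infty$ for all $p\in[1,2]$.) $\mathcal{L}^n_{r_1,\dots,r_d}$ is the space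 of $d$-linear forms $\Lambda$ on $\mathbb{R}^n\times\cdots\times\mathbb{R}^n$ ($d$ times) endowed with the norm $$\|\Lambda\|=\sup\Big\{\frac{|\Lambda(x_1,\dots,x_d)|}{\|x_1\|_{\ell_{r_1}}\cdots\|x_d\|_{\ell_{r_d}}}:\ x_1,\dots,x_d\in\mathbb{R}^n\setminus\{0\}\Big\}.$$ *)

(* Defs.v *)
From HB Require Import structures.
From mathcomp Require Import all_boot all_order all_algebra.
From mathcomp Require Import ring lra.
From mathcomp Require Import all_classical all_reals all_analysis.
(* The notations of mpoly clash with those of MathComp-Analysis. *)
From mathcomp Require Import -(notations) mpoly.

Set Implicit Arguments.
Unset Strict Implicit.
Unset Printing Implicit Defensive.

Import Order.TTheory GRing.Theory Num.Theory.
Import numFieldNormedType.Exports.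

Local Open Scope classical_set_scope.
Local Open Scope ring_scope.

Section Gaussian.
Context {R : realType}.

Definition tcons (k : nat) (x : measurableTypeR R * k.-tuple (measurableTypeR R)) :
  k.+1.-tuple (measurableTypeR R) := [the _.-tuple _ of x.1 :: x.2].

Lemma measurable_tcons k : measurable_fun setT (@tcons k).
Proof. exact: measurable_cons. Qed.

HB.instance Definition _ k :=
  isMeasurableFun.Build _ _ _ _ (@tcons k) (@measurable_tcons k).

(* N(0, I_k) is the k-fold product of N(0, 1), transported along
   R * R^k -> R^(k + 1). *)
Fixpoint std_gaussian (k : nat) :
    probability (k.-tuple (measurableTypeR R)) R :=
  match k with
  | 0 => dirac [tuple]
  | k'.+1 => distribution (normal_prob 0 1 \x std_gaussian k')%E (@tcons k')
  end.

Local Open Scope ereal_scope.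

Definition gaussian_width (k : nat) (T : set 'rV[R]_k) : \bar R :=
  \int[std_gaussian k]_g
    ereal_sup [set (\sum_(i < k) x ord0 i * tnth g i)%R%:E | x in T].

End Gaussian.

Section PolynomialMapping.
Context {R : realType} {n : nat}.
Implicit Types p : mpoly n R.

Definition multilinear_poly p : Prop :=
  forall m : multinom n, m \in msupp p -> forall j : 'I_n, (m j <= 1)%N.

Definition coef01 p : Prop :=
  forall m : multinom n, mcoeff m p = 0 \/ mcoeff m p = 1.

(* [msize] is the total degree plus one, and 0 for the zero polynomial. *)
Definition degree_le (d : nat) p : Prop := (msize p <= d.+1)%N.

Definition multiplicity_le (t : nat) p : Prop :=
  forall j : 'I_n, (count (fun m : multinom n => m j != 0%N) (msupp p) <= t)%N.

Definition poly_map (k : nat) (psi : 'I_k -> mpoly n R) (x : 'rV[R]_n) :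
  'rV[R]_k := \row_i meval (fun j => x ord0 j) (psi i).

Definition cube01 : set 'rV[R]_n :=
  [set x | forall j, x ord0 j = 0 \/ x ord0 j = 1].

End PolynomialMapping.

Section TypeConstant.
Context {R : realType} (X : normedModType R) (p : R).

(* Average over uniform signs; completeness of X plays no role. *)
Definition type_ineq (T : R) : Prop :=
  forall (k : nat) (x : 'I_k -> X),
    (2 ^+ k)^-1 * \sum_(e : {ffun 'I_k -> bool})
                     `| \sum_(i < k) (-1) ^+ (e i) *: x i | `^ p
    <= T `^ p * \sum_(i < k) `| x i | `^ p.

(* The value is +oo when no finite constant is admissible. *)
Definition type_constant : \bar R :=
  ereal_inf [set T%:E | T in [set T | 0 <= T /\ type_ineq T]].

End TypeConstant.

Section MultilinearForms.
Context {R : realType} (d n : nat).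

Definition multilinear (L : ('I_d -> 'rV[R]_n) -> R) : Prop :=
  forall (i : 'I_d) (x : 'I_d -> 'rV[R]_n),
    scalar (fun u => L (dfwith x i u)).

Definition multilinear_pred : {pred ('I_d -> 'rV[R]_n) -> R} :=
  fun L => `[< multilinear L >].

Lemma multilinear_submod_closed : submod_closed multilinear_pred.
Proof.
split; first by apply/asboolP => i x a u v; rewrite /= mulr0 addr0.
move=> c f g /asboolP mf /asboolP mg; apply/asboolP => i x a u v.
have /= ef := mf i x a u v; have /= eg := mg i x a u v.
change (c * f (dfwith x i (a *: u + v)) + g (dfwith x i (a *: u + v)) =
  a * (c * f (dfwith x i u) + g (dfwith x i u)) +
  (c * f (dfwith x i v) + g (dfwith x i v))).
by rewrite ef eg; ring.
Qed.

HB.instance Definition _ :=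
  GRing.isSubmodClosed.Build R (('I_d -> 'rV[R]_n) -> R) multilinear_pred
    multilinear_submod_closed.

Record mlform := MLForm {
  mlform_fun :> ('I_d -> 'rV[R]_n) -> R ;
  mlformP : mlform_fun \in multilinear_pred }.

HB.instance Definition _ := [isSub for mlform_fun].
HB.instance Definition _ := [Choice of mlform by <:].
HB.instance Definition _ := [SubChoice_isSubLmodule of mlform by <:].

End MultilinearForms.
Arguments mlform R d n : clear implicits.

Definition lnorm {R : realType} {n : nat} (r : R) (x : 'rV[R]_n) : R :=
  (\sum_(j < n) `| x ord0 j | `^ r) `^ r^-1.

(* The set is bounded (see [mlform_bounded]), so [sup] is its true supremum. *)
Definition mlform_norm {R : realType} {d n : nat} (r : 'I_d -> R)
    (L : mlform R d n) : R :=
  sup [set `| L x | / \prod_(i < d) lnorm (r i) (x i)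
      | x in [set x | forall i, x i != 0]].

Section MultilinearNorm.
Context {R : realType} {d n : nat}.
Implicit Types (x : 'I_d -> 'rV[R]_n) (L : mlform R d n) (r : 'I_d -> R).

Lemma mlform_multilinear L : multilinear L.
Proof. by apply/asboolP; exact: mlformP. Qed.

Lemma mlform_eq0 L x i : x i = 0 -> L x = 0.
Proof.
move=> xi0; have := mlform_multilinear L i x 1 0 0 => /=.
rewrite scaler0 addr0 mul1r.
have -> : dfwith x i 0 = x.
  by apply/funext => j; case: dfwithP => [|k ik] //; rewrite xi0.
by rewrite -[X in X = _]addr0 => /addrI.
Qed.

Lemma mlform_expand L x i :
  L x = \sum_(j < n) x i ord0 j * L (dfwith x i (delta_mx ord0 j)).
Proof.
have ml := mlform_multilinear L i x.
pose f u : R^o := L (dfwith x i u).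
have f0 : f 0 = 0 by rewrite /f (@mlform_eq0 _ _ i)// dfwithin.
have fD u v : f (u + v) = f u + f v.
  by have := ml 1 u v => /=; rewrite scale1r mul1r.
have fZ a u : f (a *: u) = a * f u.
  by have := ml a u 0 => /=; rewrite addr0 -/(f _) -/(f _) -/(f _) f0 addr0.
have -> : L x = f (x i).
  congr (L _); apply/funext => j.
  by case: dfwithP.
rewrite {1}(row_sum_delta (x i)) (big_morph f fD f0).
by apply: eq_bigr => j _; rewrite fZ.
Qed.

Lemma lnorm_ge0 (r : R) (u : 'rV[R]_n) : 0 <= lnorm r u.
Proof. exact: powR_ge0. Qed.

Lemma coord_le_lnorm (r : R) (u : 'rV[R]_n) j :
  0 < r -> `| u ord0 j | <= lnorm r u.
Proof.
move=> r0; rewrite /lnorm -[leLHS](@powRr1 R)// -(mulfV (lt0r_neq0 r0)) powRrM.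
rewrite ge0_ler_powR ?invr_ge0 ?(ltW r0)// ?nnegrE ?powR_ge0//.
  by apply: sumr_ge0 => k _; exact: powR_ge0.
by rewrite (bigD1 j)//= lerDl; apply: sumr_ge0 => k _; exact: powR_ge0.
Qed.

Lemma lnorm_gt0 (r : R) (u : 'rV[R]_n) : 0 < r -> u != 0 -> 0 < lnorm r u.
Proof.
move=> r0 u0; have [j uj] : exists j, u ord0 j != 0.
  apply/existsP; apply: contraNT u0; rewrite negb_exists => /forallP u0.
  by apply/eqP/rowP => j; rewrite mxE; apply/eqP; move: (u0 j); rewrite negbK.
by apply: lt_le_trans (coord_le_lnorm u j r0); rewrite normr_gt0.
Qed.

Lemma mlform_bounded L r : (forall i, 0 < r i) ->
  exists2 C, 0 <= C & forall x, `| L x | <= C * \prod_(i < d) lnorm (r i) (x i).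
Proof.
move=> r0.
suff H m : (m <= d)%N -> exists2 C, 0 <= C & forall x,
    (forall i : 'I_d, (m <= i)%N -> exists j, x i = delta_mx ord0 j) ->
    `| L x | <= C * \prod_(i < d | (i < m)%N) lnorm (r i) (x i).
  have [C C0 CL] := H d (leqnn _); exists C => // x.
  rewrite (le_trans (CL x _))//; first by move=> i; rewrite leqNgt ltn_ord.
  by rewrite (eq_bigl xpredT)// => i; rewrite ltn_ord.
elim: m => [_|m IH md].
  pose e (h : {ffun 'I_d -> 'I_n}) : 'I_d -> 'rV[R]_n :=
    fun i => delta_mx ord0 (h i).
  exists (\sum_h `| L (e h) |); first by apply: sumr_ge0.
  move=> x xb.
  have /boolp.choice[h xh] : forall i, exists j, x i = delta_mx ord0 j.
    by move=> i; exact: xb.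
  rewrite [X in _ * X]big_pred0 ?mulr1//.
  rewrite (_ : x = e (finfun h)); last first.
    by apply/funext => i; rewrite xh /e ffunE.
  by rewrite (bigD1 (finfun h))//= lerDl sumr_ge0.
have [C C0 CL] := IH (ltnW md).
exists (n%:R * C); first by rewrite mulr_ge0.
move=> x xm; pose k := Ordinal md.
rewrite (mlform_expand L x k) (le_trans (ler_norm_sum _ _ _))//.
rewrite (bigD1 k)//= (eq_bigl (fun i : 'I_d => (i < m)%N)); last first.
  move=> i; rewrite ltnS leq_eqVlt -(inj_eq val_inj) /=.
  by case: (ltngtP i m).
set P := \prod_(_ < _ | _) _.
apply: (@le_trans _ _ (\sum_(j < n) lnorm (r k) (x k) * (C * P))); last first.
  rewrite sumr_const card_ord -[leLHS]mulr_natl.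
  by rewrite le_eqVlt; apply/orP; left; apply/eqP; ring.
apply: ler_sum => j _; rewrite normrM ler_pM// ?coord_le_lnorm//.
apply: le_trans (CL _ _) _.
  move=> i mi; have [<-|ki] := eqVneq k i; first by exists j; rewrite dfwithin.
  rewrite dfwithout//; apply: xm; rewrite ltn_neqAle mi andbT.
  by rewrite -(inj_eq val_inj) in ki.
rewrite ler_wpM2l// le_eqVlt; apply/orP; left; apply/eqP; apply: eq_bigr => i im.
by rewrite dfwithout// -(inj_eq val_inj)/= gtn_eqF.
Qed.

Lemma mlform_norm_ge0 L r : 0 <= mlform_norm r L.
Proof.
rewrite /mlform_norm.
have [->|/set0P[y Sy]] := eqVneq [set `| L x | / \prod_(i < d) lnorm (r i) (x i)
      | x in [set x | forall i, x i != 0]] set0; first by rewrite sup0.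
have S0 z : [set `| L x | / \prod_(i < d) lnorm (r i) (x i)
      | x in [set x | forall i, x i != 0]] z -> 0 <= z.
  move=> [x _ <-]; rewrite divr_ge0//; apply: prodr_ge0 => i _.
  exact: lnorm_ge0.
have [hs|hs] := pselect (has_sup [set `| L x | / \prod_(i < d) lnorm (r i) (x i)
      | x in [set x | forall i, x i != 0]]).
  by apply: le_trans (S0 _ Sy) _; apply: ub_le_sup => //; case: hs.
by rewrite sup_out.
Qed.

Lemma mlform_norm_ub L r x : (forall i, 0 < r i) ->
  `| L x | <= mlform_norm r L * \prod_(i < d) lnorm (r i) (x i).
Proof.
move=> r0; have [x0|] := pselect (forall i, x i != 0); last first.
  move=> /existsNP[i /negP]; rewrite negbK => /eqP xi.
  rewrite (mlform_eq0 _ xi) normr0 mulr_ge0 ?mlform_norm_ge0//.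
  by apply: prodr_ge0 => j _; exact: lnorm_ge0.
have P0 (y : 'I_d -> 'rV[R]_n) : (forall i, y i != 0) -> 0 < \prod_(i < d) lnorm (r i) (y i).
  by move=> y0; apply: prodr_gt0 => i _; exact: lnorm_gt0.
rewrite -ler_pdivrMr ?P0//; apply: ub_le_sup; last by exists x.
have [C _ CL] := mlform_bounded L r0.
by exists C => _ [y y0 <-]; rewrite ler_pdivrMr ?P0.
Qed.

Lemma mlform_norm_le L r C : (forall i, 0 < r i) -> 0 <= C ->
  (forall x, `| L x | <= C * \prod_(i < d) lnorm (r i) (x i)) ->
  mlform_norm r L <= C.
Proof.
move=> r0 C0 CL; rewrite /mlform_norm.
have [->|/set0P S0] := eqVneq [set `| L x | / \prod_(i < d) lnorm (r i) (x i)
      | x in [set x | forall i, x i != 0]] set0; first by rewrite sup0.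
apply: ge_sup => // _ [x x0 <-]; rewrite ler_pdivrMr//.
by apply: prodr_gt0 => i _; exact: lnorm_gt0.
Qed.

End MultilinearNorm.

(* The space of d-linear forms on R^n with the norm [mlform_norm r]; the
   exponents enter the type because the norm depends on them. *)
Definition mlspace {R : realType} {d : nat} (n : nat) {r : 'I_d -> R}
  (r1 : forall i, 1 <= r i) : Type := mlform R d n.

Section MultilinearSpace.
Context {R : realType} {d n : nat} {r : 'I_d -> R}.
Variable r1 : forall i, 1 <= r i.
Local Notation V := (mlspace n r1).

Let r0 i : 0 < r i. Proof. exact: lt_le_trans (r1 i). Qed.

HB.instance Definition _ := GRing.Lmodule.on V.

Let N (L : V) : R := mlform_norm r (L : mlform R d n).

Let ND (L M : V) : N (L + M) <= N L + N M.
Proof.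
apply: mlform_norm_le => //; first by rewrite addr_ge0 ?mlform_norm_ge0.
move=> x; rewrite mulrDl (le_trans (ler_normD _ _))//.
by rewrite lerD ?mlform_norm_ub.
Qed.

Let NZ_le (a : R) (L : V) : N (a *: L) <= `|a| * N L.
Proof.
apply: mlform_norm_le => //; first by rewrite mulr_ge0 ?mlform_norm_ge0.
move=> x; have -> : (a *: L : mlform R d n) x = a * (L : mlform R d n) x by [].
by rewrite normrM -mulrA ler_wpM2l ?mlform_norm_ub.
Qed.

Let NZ (a : R) (L : V) : N (a *: L) = `|a| * N L.
Proof.
apply/eqP; rewrite eq_le NZ_le /=.
have [->|a0] := eqVneq a 0; first by rewrite normr0 mul0r mlform_norm_ge0.
have := NZ_le a^-1 (a *: L).
by rewrite scalerA mulVf// scale1r normfV ler_pdivlMl ?normr_gt0.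
Qed.

Let N0 (L : V) : N L = 0 -> L = 0.
Proof.
move=> L0; apply: val_inj; apply/funext => x /=; apply/eqP.
have := mlform_norm_ub (L : mlform R d n) x r0; rewrite -/(N L) L0 mul0r.
by rewrite normr_le0.
Qed.

HB.instance Definition _ := Lmodule_isNormed.Build R V ND NZ N0.

Lemma mlspace_normE (L : V) : `| L | = mlform_norm r (L : mlform R d n).
Proof. by []. Qed.

End MultilinearSpace.

(* Main.v *)
Require Import Defs.
From HB Require Import structures.
From mathcomp Require Import all_boot all_order all_algebra.
From mathcomp Require Import all_classical all_reals all_analysis.
From mathcomp Require Import -(notations) mpoly.
From mathcomp Require Import measurable_realfun ring lra.

(** The supremum defining the Gaussian width ranges over the values
[<psi x, g>], and on the cube each [psi i] agrees with a multilinear form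
evaluated on the diagonal: since [y ^+ 2 = y] for [y] in [{0, 1}], a nonconstant
monomial with at most [d] variables may be written as a product of exactly [d]
coordinates, repeating a variable if necessary. So
[psi i x = c i + L i (x, .., x)] with a constant [c i] in [{0, 1}] and a
[d]-linear form [L i] ([poly_on_cube_multilinear_form]).

The conjugacy condition on the exponents enters twice. By a form of Young's
inequality ([prod_le_sum_powR]) and because a variable lies in at most [t]
monomials, [L i] has norm at most [d * t]
([sum_prod_coord_form_norm]). A point of the cube has [l_r] norm at most
[n `^ r^-1], and these factors multiply to [n], so that a form [L] is bounded by
[n * `|L|] on the cube ([mlform_cube_le]). The constants [c i] are absorbed in the
same way: they are the values at the all-ones point of multiples of a product of
coordinates, a form of norm at most [1]. Hence, writing [M i] for these multiples,
[sup_x <psi x, g>] is at most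
[n * (`|\sum_i g i *: L i| + `|\sum_i g i *: M i|)].

The law of [g] is invariant under independent changes of sign of the coordinates
([std_gaussian_sign_flip]), so the width is also the expectation of the average of
the supremum over all sign patterns. For a fixed [g], that average is controlled by
the type inequality applied to the vectors [g i *: L i] and [g i *: M i]. The
result ([type_ineq_weighted]) is a multiple of [T * k `^ p^-1] times an affine
function of the mean of the [g i ^+ 2], and only the second moment of a Gaussian is
then needed. Since the norms have been bounded pointwise, the only functions to be
integrated are a finite maximum of linear functions and a quadratic polynomial, so
that the measurability of the norm of a random form never comes up. *)

Set Implicit Arguments.
Unset Strict Implicit.
Unset Printing Implicit Defensive.

Import Order.TTheory GRing.Theory Num.Theory.
Import numFieldNormedType.Exports.

Local Open Scope classical_set_scope.
Local Open Scope ring_scope.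

(** * The standard Gaussian measure *)

Lemma integral_probability_cst (d : measure_display) (T : measurableType d)
    (R : realType) (P : probability T R) (c : \bar R) :
  (\int[P]_(_ in setT) c = c)%E.
Proof.
have -> : (\int[P]_(_ in setT) c = c * P setT)%E by exact: integral_cst.
by rewrite probability_setT mule1.
Qed.

Section StandardGaussian.
Context {R : realType}.
Local Open Scope ereal_scope.
Local Notation mu := (@lebesgue_measure R).
Local Notation N01 := (@normal_prob R 0 1).

(** The density [normal_pdf] agrees almost everywhere with the Radon-Nikodym
derivative of [normal_prob], for which the change of measure is known. *)
Lemma ge0_integral_normal_prob (m s : R) (f : R -> \bar R) :
  measurable_fun [set: R] f -> (forall x, 0 <= f x) ->
  \int[normal_prob m s]_x f x = \int[mu]_x (f x * (normal_pdf m s x)%:E).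
Proof.
move=> mf f0.
have dom := normal_prob_dominates m s.
have mpdf : measurable_fun [set: R] (fun x => (normal_pdf m s x)%:E).
  by apply/measurable_EFinP; exact: measurable_normal_pdf.
have pdf_ge0 x : 0 <= (normal_pdf m s x)%:E by rewrite lee_fin normal_pdf_ge0.
have RNi := Radon_Nikodym_SigmaFinite.f_integrable dom.
have mRN := measurable_int _ RNi.
rewrite -(Radon_Nikodym_SigmaFinite.change_of_variables dom)//.
apply: ge0_ae_eq_integral => //.
- exact: emeasurable_funM.
- exact: emeasurable_funM.
- by move=> x _; rewrite mule_ge0// Radon_Nikodym_SigmaFinite.f_ge0.
- by move=> x _; rewrite mule_ge0.
apply: ae_eqe_mul2l; apply: integral_ae_eq => // A _ mA.
by rewrite -Radon_Nikodym_SigmaFinite.f_integral.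
Qed.

Lemma normal_prob_opp (f : R -> \bar R) :
  measurable_fun [set: R] f -> (forall x, 0 <= f x) ->
  \int[N01]_x f (- x)%R = \int[N01]_x f x.
Proof.
move=> mf f0.
have mN : measurable_fun setT (-%R : measurableTypeR R -> measurableTypeR R).
  exact: oppr_measurable.
have mpdf : measurable_fun [set: R] (fun x => (normal_pdf 0 1 x)%:E : \bar R).
  by apply/measurable_EFinP; exact: measurable_normal_pdf.
rewrite !ge0_integral_normal_prob//; last exact: (measurableT_comp mf mN).
pose h (x : R) := f x * (normal_pdf 0 1 x)%:E.
transitivity (\int[mu]_x h (- x)%R).
  apply: eq_integral => x _; rewrite /h; congr (_ * _%:E).
  by rewrite !normal_pdfE// /normal_fun !subr0 sqrrN.
have mh : measurable_fun [set: R] h by exact: emeasurable_funM.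
have h0 x : 0 <= h x by rewrite mule_ge0// lee_fin normal_pdf_ge0.
transitivity (\int[pushforward mu (-%R : _ -> measurableTypeR R)]_x h x).
  by rewrite ge0_integral_pushforward.
by apply: eq_measure_integral => A mA _; exact: lebesgue_measureN.
Qed.

(** Only finiteness matters, so the second moment is not computed: [x ^+ 2] is
dominated by a multiple of [expR (3 / 8 * x ^+ 2)], the ratio between the densities
of variance [4] and [1] up to a constant, and this turns the integral into the total
mass of the wider Gaussian. *)
Lemma normal_prob_second_moment :
  exists2 C : R, (0 <= C)%R & \int[N01]_x (x ^+ 2)%:E <= C%:E.
Proof.
pose C : R := (8 * (normal_peak 1 / normal_peak 2))%R.
have pk0 : (0 < @normal_peak R 2)%R by apply: normal_peak_gt0.
have C0 : (0 <= C)%R by rewrite mulr_ge0// divr_ge0 ?normal_peak_ge0.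
exists C => //.
have mX : measurable_fun [set: R] (fun x : R => (x ^+ 2)%:E).
  by apply/measurable_EFinP; exact: measurable_funX.
have mpdf s : measurable_fun setT (fun x : R => (normal_pdf 0 s x)%:E).
  by apply/measurable_EFinP; exact: measurable_normal_pdf.
rewrite ge0_integral_normal_prob//; last by move=> x; rewrite lee_fin sqr_ge0.
apply: (@le_trans _ _ (\int[mu]_x (C%:E * (normal_pdf 0 2 x)%:E))).
  apply: ge0_le_integral => //.
  - by move=> x _; rewrite -EFinM lee_fin mulr_ge0 ?sqr_ge0 ?normal_pdf_ge0.
  - exact: (emeasurable_funM mX (mpdf 1%R)).
  - exact: (measurable_funeM _ (mpdf 2%R)).
  move=> x _; rewrite -!EFinM lee_fin !normal_pdfE//= /C.
  rewrite [leLHS]mulrCA [leRHS](_ : _ = normal_peak 1 * (8 * normal_fun 0 2 x))%R;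
    last by field; rewrite gt_eqF.
  rewrite ler_wpM2l ?normal_peak_ge0// /normal_fun subr0.
  set u := (x ^+ 2)%R; have u0 : (0 <= u)%R by exact: sqr_ge0.
  have -> : (- u / (1 ^+ 2 *+ 2) = - u / (2 ^+ 2 *+ 2) - 3 / 8 * u)%R by field.
  rewrite expRD mulrCA [leRHS]mulrC ler_wpM2l ?expR_ge0//.
  rewrite expRN ler_pdivrMr ?expR_gt0//.
  have := expR_ge1Dx (3 / 8 * u)%R; nra.
rewrite ge0_integralZl ?integral_normal_pdf ?mule1//.
  exact: (mpdf 2%R).
by move=> x _; rewrite lee_fin normal_pdf_ge0.
Qed.

Lemma ge0_integral_std_gaussianS k (f : k.+1.-tuple (measurableTypeR R) -> \bar R) :
  measurable_fun setT f -> (forall x, 0 <= f x) ->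
  \int[std_gaussian k.+1]_g f g =
  \int[N01]_x \int[std_gaussian k]_g f (tcons (x, g)).
Proof.
move=> mf f0 /=; rewrite ge0_integral_distribution//.
rewrite fubini_tonelli1//=.
by apply: measurableT_comp => //; exact: measurable_tcons.
Qed.

Lemma measurable_slice_tcons k (f : k.+1.-tuple (measurableTypeR R) -> \bar R) x :
  measurable_fun setT f ->
  measurable_fun setT (fun g : k.-tuple (measurableTypeR R) => f (tcons (x, g))).
Proof.
move=> mf; apply: (measurableT_comp mf).
by apply: (measurableT_comp (@measurable_tcons R k)); exact: measurable_pair1.
Qed.

Lemma tnth_tcons0 k (x : R) (g : k.-tuple R) : tnth (tcons (x, g)) ord0 = x.
Proof. by []. Qed.

Lemma tnth_tconsS k (x : R) (g : k.-tuple R) i :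
  tnth (tcons (x, g)) (lift ord0 i) = tnth g i.
Proof. by rewrite /tcons (tnth_nth x) /= (tnth_nth x). Qed.

Lemma integral_coord_std_gaussian k (i : 'I_k) (h : R -> \bar R) :
  measurable_fun [set: R] h -> (forall x, 0 <= h x) ->
  \int[std_gaussian k]_g h (tnth g i) = \int[N01]_x h x.
Proof.
move=> mh h0; elim: k i => [[]//|k IH] i.
rewrite ge0_integral_std_gaussianS//; last first.
  by apply: (measurableT_comp mh); exact: measurable_tnth.
case: (unliftP ord0 i) => [j ->|->].
  under eq_integral => x _.
    under eq_integral => g _ do rewrite tnth_tconsS.
    rewrite IH; over.
  exact: integral_probability_cst.
apply: eq_integral => x _.
rewrite -[RHS](integral_probability_cst (std_gaussian k)).
by apply: eq_integral => g _; rewrite tnth_tcons0.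
Qed.

Definition sign_flip k (e : 'I_k -> bool) (g : k.-tuple R) : k.-tuple R :=
  [tuple ((-1) ^+ e i * tnth g i)%R | i < k].

Lemma measurable_sign_flip k (e : 'I_k -> bool) :
  measurable_fun setT (sign_flip e : k.-tuple (measurableTypeR R) ->
                                     k.-tuple (measurableTypeR R)).
Proof.
apply/measurable_fun_tnthP => i.
rewrite (_ : _ \o _ = fun g => ((-1) ^+ e i * tnth g i)%R); last first.
  by apply/funext => g /=; rewrite tnth_mktuple.
apply: measurable_funM => //; exact: measurable_tnth.
Qed.

Lemma sign_flip_tcons k (e : 'I_k.+1 -> bool) x (g : k.-tuple R) :
  sign_flip e (tcons (x, g)) =
  tcons (((-1) ^+ e ord0 * x)%R, sign_flip (e \o lift ord0) g).
Proof.
apply: eq_from_tnth => i; rewrite tnth_mktuple.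
by case: (unliftP ord0 i) => [j ->|->]; rewrite ?tnth_tconsS ?tnth_mktuple.
Qed.

(** By induction on the dimension: Tonelli's theorem splits off the first
coordinate, whose law is even. *)
Lemma std_gaussian_sign_flip k (e : 'I_k -> bool)
    (f : k.-tuple (measurableTypeR R) -> \bar R) :
  measurable_fun setT f -> (forall g, 0 <= f g) ->
  \int[std_gaussian k]_g f (sign_flip e g) = \int[std_gaussian k]_g f g.
Proof.
elim: k e f => [|k IH] e f mf f0.
  by apply: eq_integral => g _; rewrite [sign_flip e g]tuple0 [g in RHS]tuple0.
rewrite !ge0_integral_std_gaussianS//; last first.
  by apply: measurableT_comp => //; exact: measurable_sign_flip.
pose F x := \int[std_gaussian k]_g f (tcons (x, g)).
have F0 x : 0 <= F x by exact: integral_ge0.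
have mF : measurable_fun [set: R] F.
  apply: (measurable_fun_fubini_tonelli_F (f \o (@tcons R k))).
    by apply: measurableT_comp => //; exact: measurable_tcons.
  by move=> x; exact: f0.
transitivity (\int[N01]_x F ((-1) ^+ e ord0 * x)%R).
  apply: eq_integral => x _; under eq_integral do rewrite sign_flip_tcons.
  by rewrite (IH _ (fun g => f (tcons (_, g))))//; exact: measurable_slice_tcons.
case: (e ord0); last by under eq_integral do rewrite mul1r.
under eq_integral do rewrite mulN1r.
exact: normal_prob_opp.
Qed.

End StandardGaussian.

(** * Type inequality with bounded coefficients *)

Section RademacherType.
Context {R : realType}.

Lemma le_1DpowR (b p : R) : 0 <= b -> 1 <= p -> b <= 1 + b `^ p.
Proof.
move=> b0 p1; have [b1|/ltW b1] := leP b 1.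
  by rewrite (le_trans b1)// lerDl powR_ge0.
by rewrite (@le_trans _ _ (b `^ p))// ?lerDr// -[leLHS]powRr1// ler_powR.
Qed.

Lemma powR_le_1Dsqr (b p : R) : 0 <= b -> 1 <= p -> p <= 2 ->
  b `^ p <= 1 + b ^+ 2.
Proof.
move=> b0 p1 p2; have [b1|/ltW b1] := leP b 1.
  rewrite (@le_trans _ _ 1)// ?lerDl ?sqr_ge0//.
  rewrite (_ : 1 = 1 `^ p); last by rewrite powR1.
  by rewrite ge0_ler_powR ?nnegrE// (le_trans _ p1).
by rewrite (@le_trans _ _ (b `^ 2))// ?ler_powR// powR_mulrn// lerDr.
Qed.

(** A substitute for the power mean inequality that takes no [p]-th root of the
bound: averaging [a i <= D * (1 + (a i / D) `^ p)] already gives a bound linear in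
[A]. *)
Lemma le_power_mean_shift (I : finType) (a : I -> R) (p A D : R) :
  (forall i, 0 <= a i) -> 1 <= p -> 0 < D ->
  #|I|%:R^-1 * \sum_i a i `^ p <= D `^ p * A ->
  #|I|%:R^-1 * \sum_i a i <= D * (1 + A).
Proof.
move=> a0 p1 D0 aA; have Dp0 : 0 < D `^ p by exact: powR_gt0.
have ale i : a i <= D + D / D `^ p * a i `^ p.
  have := @le_1DpowR (a i / D) p (divr_ge0 (a0 i) (ltW D0)) p1.
  rewrite ler_pdivrMr// => /le_trans; apply.
  rewrite powRM ?invr_ge0 ?(ltW D0)// -powR_inv1 ?(ltW D0)// -powRrM mulN1r powRN.
  by rewrite le_eqVlt; apply/orP; left; apply/eqP; ring.
apply: (@le_trans _ _ (#|I|%:R^-1 * \sum_i (D + D / D `^ p * a i `^ p))).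
  by rewrite ler_wpM2l ?invr_ge0 ?ler0n// ler_sum.
rewrite big_split/= mulrDr mulrDr -mulr_sumr mulrCA lerD//.
  rewrite sumr_const -[D *+ _]mulr_natr mulrCA ler_pM2l//.
  by have [->|I0] := eqVneq #|I|%:R (0 : R); rewrite ?mulr0// mulVf.
by rewrite -mulrA ler_pM2l// ler_pdivrMl.
Qed.

(** With [D := T * t * k `^ p^-1], the type inequality bounds the mean of the
[p]-th powers by [D `^ p] times the mean of the [`|g i| `^ p], and
[`|g i| `^ p <= 1 + g i ^+ 2] because [1 <= p <= 2]. The bound is affine in the
[g i ^+ 2], hence easy to integrate. *)
Lemma type_ineq_weighted (X : normedModType R) (p T t : R) (k : nat)
    (x : 'I_k -> X) (g : 'I_k -> R) :
  (0 < k)%N -> 1 <= p -> p <= 2 -> 0 <= T -> type_ineq X p T ->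
  0 < t -> (forall i, `|x i| <= t) ->
  (2 ^+ k)^-1 * \sum_(e : {ffun 'I_k -> bool})
                   `|\sum_(i < k) (-1) ^+ e i *: (g i *: x i)|
    <= T * t * k%:R `^ p^-1 * (2 + k%:R^-1 * \sum_(i < k) g i ^+ 2).
Proof.
move=> k0 p1 p2 T0 typeT t0 xt.
have p0 : 0 < p by exact: lt_le_trans p1.
have kR0 : (0 : R) < k%:R by rewrite ltr0n.
have cardE : (2 ^+ k : R) = #|{: {ffun 'I_k -> bool}}|%:R.
  by rewrite card_ffun card_bool card_ord natrX.
set a := fun e : {ffun 'I_k -> bool} => `|\sum_(i < k) (-1) ^+ e i *: (g i *: x i)|.
have typea : (2 ^+ k)^-1 * \sum_e a e `^ p
    <= T `^ p * \sum_(i < k) `|g i *: x i| `^ p.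
  exact: typeT.
have sumle : \sum_(i < k) `|g i *: x i| `^ p
    <= t `^ p * (k%:R + \sum_(i < k) g i ^+ 2).
  have -> : k%:R = \sum_(i < k) (1 : R) by rewrite sumr_const card_ord.
  rewrite -big_split mulr_sumr; apply: ler_sum => i _ /=.
  rewrite normrZ powRM// mulrC ler_pM ?powR_ge0//.
    by rewrite ge0_ler_powR ?nnegrE// ?(ltW p0) ?(ltW t0).
  by rewrite -[g i ^+ 2]real_normK ?num_real// powR_le_1Dsqr.
(* For T = 0 the scale D vanishes; the type inequality then forces every signed
   sum to be zero. *)
have [T_eq0|Tneq0] := eqVneq T 0.
  have a_eq0 e : a e = 0.
    have : \sum_e a e `^ p <= 0.
      move: typea; rewrite T_eq0 powR0 ?gt_eqF// mul0r pmulr_rle0//.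
    move=> suma; have /eqP : \sum_e a e `^ p = 0.
      by apply/eqP; rewrite eq_le suma sumr_ge0// => ? _; exact: powR_ge0.
    rewrite psumr_eq0 => [/allP/(_ e)|? _]; last exact: powR_ge0.
    by rewrite mem_index_enum /= => /(_ isT) /eqP /powR_eq0_eq0.
  have -> : \sum_e a e = 0 by apply: big1 => e _; exact: a_eq0.
  by rewrite mulr0 T_eq0 !mul0r.
have T_gt0 : 0 < T by rewrite lt_neqAle eq_sym Tneq0.
rewrite (_ : 2 + _ = 1 + (1 + k%:R^-1 * \sum_(i < k) g i ^+ 2)); last by ring.
have kp0 : 0 < k%:R `^ p^-1 :> R by exact: powR_gt0.
rewrite cardE; apply: (@le_power_mean_shift _ a p); rewrite ?mulr_gt0// -?cardE.
  by move=> e; exact: normr_ge0.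
apply: (le_trans typea); rewrite !powRM ?mulr_ge0 ?(ltW T_gt0) ?(ltW t0) ?(ltW kp0)//.
rewrite -powRrM mulVf ?gt_eqF// powRr1 ?(ltW kR0)// -!mulrA.
rewrite ler_wpM2l ?powR_ge0// (le_trans sumle)//.
rewrite ler_wpM2l ?powR_ge0// le_eqVlt; apply/orP; left; apply/eqP.
by field; rewrite gt_eqF.
Qed.

End RademacherType.

(** * Norms of multilinear forms *)

Section MultilinearFormBounds.
Context {R : realType}.

Lemma prodr_powR (I : Type) (l : seq I) (P : pred I) (F : I -> R) (a : R) :
  0 < a -> \prod_(i <- l | P i) a `^ F i = a `^ (\sum_(i <- l | P i) F i).
Proof.
move=> a0; elim/big_rec2: _ => [|i x y _ ->]; first by rewrite powRr0.
by rewrite powRD// (gt_eqF a0) implybT.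
Qed.

(** Each [a i] is at most [M `^ (r i)^-1], where [M] is the right-hand side, and the
exponents add up to [1]. The weights [(r i)^-1] of the sharp Young inequality would
only improve a factor [d]. *)
Lemma prod_le_sum_powR (d : nat) (r a : 'I_d -> R) :
  (forall i, 0 < r i) -> \sum_i (r i)^-1 = 1 -> (forall i, 0 <= a i) ->
  \prod_i a i <= \sum_i a i `^ r i.
Proof.
move=> r0 rsum a0; set M := \sum_i _.
have a_le i : a i `^ r i <= M.
  by rewrite /M (bigD1 i)//= lerDl sumr_ge0// => j _; exact: powR_ge0.
have M0 : 0 <= M by rewrite sumr_ge0// => j _; exact: powR_ge0.
have [M_eq0|M_neq0] := eqVneq M 0.
  have [i|d0] := pickP 'I_d; last first.
    have sum0 : \sum_i (r i)^-1 = 0 by exact: big_pred0.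
    by move/eqP: rsum; rewrite sum0 eq_sym oner_eq0.
  have ai0 : a i = 0.
    by apply: (@powR_eq0_eq0 _ _ (r i)); apply/le_anti; rewrite powR_ge0 -M_eq0 a_le.
  by rewrite (bigD1 i)//= ai0 mul0r.
have M_gt0 : 0 < M by rewrite lt_neqAle eq_sym M_neq0.
rewrite -[leRHS](powRr1 M0) -[X in _ `^ X]rsum -prodr_powR//.
apply: ler_prod => i _; rewrite a0 /=.
rewrite -[leLHS](powRr1 (a0 i)) -(mulfV (lt0r_neq0 (r0 i))) powRrM.
by rewrite ge0_ler_powR ?nnegrE ?powR_ge0 ?invr_ge0 ?(ltW (r0 i)).
Qed.

Lemma sum_le_count (I : Type) (l : seq I) (n : nat) (s : I -> 'I_n) (t : nat)
    (f : 'I_n -> R) :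
  (forall v, 0 <= f v) -> (forall v, (count (fun m => s m == v) l <= t)%N) ->
  \sum_(m <- l) f (s m) <= t%:R * \sum_v f v.
Proof.
move=> f0 st; rewrite mulr_sumr.
have -> : \sum_(m <- l) f (s m) = \sum_(m <- l) \sum_v (s m == v)%:R * f v.
  apply: eq_bigr => m _; rewrite (bigD1 (s m))//= eqxx mul1r big1 ?addr0// => v vs.
  by rewrite eq_sym (negbTE vs) mul0r.
rewrite exchange_big /=; apply: ler_sum => v _; rewrite -mulr_suml.
rewrite ler_wpM2r// -natr_sum ler_nat (leq_trans _ (st v))//.
by rewrite -sum1_count [leqRHS]big_mkcond; apply: leq_sum => m _; case: eqP.
Qed.

Lemma lnorm_powR (n : nat) (r : R) (u : 'rV[R]_n) : 0 < r ->
  lnorm r u `^ r = \sum_j `|u ord0 j| `^ r.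
Proof.
move=> r0; rewrite /lnorm -powRrM mulVf ?gt_eqF// powRr1//.
by apply: sumr_ge0 => j _; exact: powR_ge0.
Qed.

(** After normalizing each [x i] in [l_(r i)], Young's inequality separates the
coordinates; in the [i]-th slot every coordinate is read at most [t] times, so that
slot contributes at most [t]. *)
Lemma sum_prod_le_lnorm (I : Type) (d n t : nat) (r : 'I_d -> R) (l : seq I)
    (s : I -> 'I_d -> 'I_n) (x : 'I_d -> 'rV[R]_n) :
  (forall i, 0 < r i) -> \sum_i (r i)^-1 = 1 ->
  (forall i v, (count (fun m => s m i == v) l <= t)%N) ->
  \sum_(m <- l) \prod_i `|x i ord0 (s m i)|
    <= (d * t)%:R * \prod_i lnorm (r i) (x i).
Proof.
move=> r0 rsum st.
have N_ge0 i : 0 <= lnorm (r i) (x i) by exact: lnorm_ge0.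
have [x0|] := pselect (forall i, x i != 0); last first.
  move=> /existsNP[i /negP]; rewrite negbK => /eqP xi0.
  rewrite big1 ?mulr_ge0// ?prodr_ge0// => m _.
  by rewrite (bigD1 i)//= xi0 mxE normr0 mul0r.
have N_gt0 i : 0 < lnorm (r i) (x i) by exact: lnorm_gt0.
pose y i v := `|x i ord0 v| / lnorm (r i) (x i).
have y_ge0 i v : 0 <= y i v by rewrite divr_ge0.
have sumy i : \sum_v y i v `^ r i = 1.
  rewrite (eq_bigr (fun v => `|x i ord0 v| `^ r i / lnorm (r i) (x i) `^ r i)).
    by rewrite -mulr_suml -lnorm_powR// mulfV// gt_eqF// powR_gt0.
  move=> v _; rewrite powRM ?invr_ge0//; congr (_ * _).
  by rewrite -powR_inv1// -powRrM mulN1r powRN.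
have -> : \sum_(m <- l) \prod_i `|x i ord0 (s m i)| =
    (\sum_(m <- l) \prod_i y i (s m i)) * \prod_i lnorm (r i) (x i).
  rewrite mulr_suml; apply: eq_bigr => m _; rewrite -big_split/=.
  by apply: eq_bigr => i _; rewrite /y divfK// gt_eqF.
rewrite ler_wpM2r ?prodr_ge0//.
apply: (@le_trans _ _ (\sum_(m <- l) \sum_i y i (s m i) `^ r i)).
  by apply: ler_sum => m _; exact: prod_le_sum_powR.
rewrite exchange_big/= natrM -[d in d%:R]card_ord -sumr_const mulr_suml.
apply: ler_sum => i _; rewrite mul1r.
rewrite (le_trans (@sum_le_count I l n (s^~ i) t (fun v => y i v `^ r i) _ _))//.
  by move=> v; exact: powR_ge0.
by rewrite sumy mulr1.
Qed.

Lemma multilinear_prod_coord (d n : nat) (s : 'I_d -> 'I_n) :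
  (fun x : 'I_d -> 'rV[R]_n => \prod_i x i ord0 (s i)) \in @multilinear_pred R d n.
Proof.
apply/asboolP => i x a u v /=.
have E w : \prod_j dfwith x i w j ord0 (s j) =
    w ord0 (s i) * \prod_(j < d | j != i) x j ord0 (s j).
  rewrite (bigD1 i)//= dfwithin; congr (_ * _).
  by apply: eq_bigr => j ji; rewrite dfwithout// eq_sym.
by rewrite (E (a *: u + v)) (E u) (E v) 2!mxE mulrDl mulrA.
Qed.

Definition prod_coord_form (d n : nat) (s : 'I_d -> 'I_n) : mlform R d n :=
  MLForm (multilinear_prod_coord s).

Lemma mlform_sumE (d n : nat) (I : Type) (l : seq I) (P : pred I)
    (L : I -> mlform R d n) x :
  (\sum_(i <- l | P i) L i) x = \sum_(i <- l | P i) L i x.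
Proof. by apply: (big_morph (fun M : mlform R d n => M x)). Qed.

Lemma sum_prod_coord_form_norm (I : Type) (d n t : nat) (r : 'I_d -> R)
    (l : seq I) (s : I -> 'I_d -> 'I_n) :
  (forall i, 0 < r i) -> \sum_i (r i)^-1 = 1 ->
  (forall i v, (count (fun m => s m i == v) l <= t)%N) ->
  mlform_norm r (\sum_(m <- l) prod_coord_form (s m)) <= (d * t)%:R.
Proof.
move=> r0 rsum st; apply: mlform_norm_le => // x; rewrite mlform_sumE.
apply: le_trans (sum_prod_le_lnorm x r0 rsum st).
rewrite (le_trans (ler_norm_sum _ _ _))// ler_sum// => m _.
by rewrite normr_prod.
Qed.

(** A point of the cube has [l_r] norm at most [n `^ r^-1], and
[\sum_i (r i)^-1 = 1]. *)
Lemma mlform_cube_le (d n : nat) (r : 'I_d -> R) (L : mlform R d n)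
    (x : 'rV[R]_n) :
  (0 < n)%N -> (forall i, 0 < r i) -> \sum_i (r i)^-1 = 1 -> cube01 x ->
  `|L (fun=> x)| <= n%:R * mlform_norm r L.
Proof.
move=> n0 r0 rsum x01; rewrite (le_trans (mlform_norm_ub L _ r0))// mulrC.
rewrite ler_wpM2r ?mlform_norm_ge0//.
have nR0 : (0 : R) < n%:R by rewrite ltr0n.
rewrite -[leRHS](powRr1 (ltW nR0)) -[X in _ `^ X]rsum -prodr_powR//.
apply: ler_prod => i _; rewrite lnorm_ge0 /= /lnorm.
rewrite ge0_ler_powR ?nnegrE ?invr_ge0 ?(ltW (r0 i))// ?(ltW nR0)//.
  by apply: sumr_ge0 => j _; exact: powR_ge0.
rewrite -[n in n%:R]card_ord -sumr_const; apply: ler_sum => j _.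
by case: (x01 j) => ->; rewrite ?normr0 ?normr1 ?powR1// powR0 ?gt_eqF.
Qed.

End MultilinearFormBounds.

(** * Polynomials on the cube *)

Section PolynomialOnCube.
Context {R : realType}.

Lemma support_enumeration (d n : nat) (m : multinom n) :
  m != mnm0 -> (mdeg m <= d)%N ->
  exists s : 'I_d -> 'I_n, (forall i, m (s i) != 0%N) /\
    (forall v, m v != 0%N -> exists i, s i = v).
Proof.
move=> m0 md; pose A := [pred v | m v != 0%N].
have size_le : (size (enum A) <= d)%N.
  apply: leq_trans md; rewrite -cardE -sum1_card mdegE big_mkcond/=.
  by apply: leq_sum => v _; rewrite inE; case: (m v).
have [v0 v0A] : exists v0, v0 \in A.
  apply/existsP; apply: contraNT m0; rewrite negb_exists => /forallP m0.
  rewrite -mdeg_eq0 mdegE big1// => v _.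
  by apply/eqP; move: (m0 v); rewrite inE negbK.
(* Beyond the end of the enumeration, the default v0 repeats a variable of the
   support. *)
exists (fun i => nth v0 (enum A) i); split => [i|v mv].
  have [iA|iA] := ltnP i (size (enum A)); last by rewrite nth_default.
  by have := mem_nth v0 iA; rewrite mem_enum.
have vA : v \in enum A by rewrite mem_enum.
have iA : (index v (enum A) < d)%N.
  by apply: leq_trans size_le; rewrite index_mem.
by exists (Ordinal iA); rewrite /= nth_index.
Qed.

Lemma monomial_on_cube (d n : nat) (m : multinom n) (s : 'I_d -> 'I_n)
    (x : 'rV[R]_n) :
  (forall i, m (s i) != 0%N) -> (forall v, m v != 0%N -> exists i, s i = v) ->
  cube01 x ->
  \prod_v x ord0 v ^+ m v = \prod_i x ord0 (s i).
Proof.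
move=> sm ms x01.
have [[v mv xv]|nox] := pselect (exists2 v, m v != 0%N & x ord0 v = 0).
  have [i si] := ms _ mv.
  rewrite (bigD1 v)//= xv expr0n (negbTE mv) mul0r.
  by rewrite (bigD1 i)//= si xv mul0r.
have x1 v : m v != 0%N -> x ord0 v = 1.
  by move=> mv; case: (x01 v) => // xv; case: nox; exists v.
rewrite [RHS]big1 => [|i _]; last exact: x1.
rewrite big1// => v _; have [->|mv] := eqVneq (m v) 0%N; first by rewrite expr0.
by rewrite x1// expr1n.
Qed.

(** The constant term is kept apart: the empty monomial has no variable to repeat,
and its value on the cube is not that of a product of coordinates. *)
Lemma poly_on_cube_multilinear_form (d n t : nat) (r : 'I_d -> R)
    (q : mpoly n R) :
  (0 < n)%N -> (forall i, 0 < r i) -> \sum_i (r i)^-1 = 1 ->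
  coef01 q -> degree_le d q -> multiplicity_le t q ->
  exists L : mlform R d n, mlform_norm r L <= (d * t)%:R /\
    forall x : 'rV[R]_n, cube01 x ->
      meval (fun j => x ord0 j) q = mcoeff mnm0 q + L (fun=> x).
Proof.
move=> n0 r0 rsum q01 qd qt.
have /boolp.choice[s sP] (m : multinom n) : exists s : 'I_d -> 'I_n,
    m != mnm0 -> (mdeg m <= d)%N -> (forall i, m (s i) != 0%N) /\
    (forall v, m v != 0%N -> exists i, s i = v).
  have [m0|m0] := eqVneq m mnm0; first by exists (fun=> Ordinal n0).
  have [md|md] := leqP (mdeg m) d; last by exists (fun=> Ordinal n0).
  by have [s sP] := support_enumeration m0 md; exists s.
have {}sP m : m \in msupp q -> m != mnm0 -> (forall i, m (s m i) != 0%N) /\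
    (forall v, m v != 0%N -> exists i, s m i = v).
  by move=> mq m0; apply: sP => //; rewrite -ltnS (leq_trans (msize_mdeg_lt mq)).
pose l := [seq m <- msupp q | m != mnm0].
exists (\sum_(m <- l) prod_coord_form (s m)); split => [|x x01].
  apply: sum_prod_coord_form_norm => // i v; apply: leq_trans (qt v).
  rewrite count_filter (@eq_in_count _ _
    (fun m => (s m i == v) && (m != mnm0) && (m v != 0%N))).
    by apply: sub_count => m /= /andP[].
  move=> m mq /=; case: eqP => //= <-; case: eqVneq => //= m0.
  by have [-> _] := sP m mq m0.
rewrite mevalE mlform_sumE big_filter.
transitivity (mcoeff mnm0 q +
    \sum_(m <- msupp q | m != mnm0) mcoeff m q * \prod_j x ord0 j ^+ m j).
  have [q0|q0] := boolP (mnm0 \in msupp q).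
    rewrite (bigD1_seq mnm0)//= ?msupp_uniq//; congr (_ + _).
    by rewrite big1 ?mulr1// => j _; rewrite mnm0E expr0.
  move: (q0); rewrite mcoeff_msupp negbK => /eqP ->; rewrite add0r.
  rewrite big_seq [RHS]big_seq_cond; apply: eq_bigl => m.
  by case: eqVneq => [->|]; rewrite ?(negbTE q0) ?andbT.
congr (_ + _); rewrite [LHS]big_seq_cond [RHS]big_seq_cond; apply: eq_bigr => m.
move=> /andP[mq m0]; have [sm ms] := sP m mq m0.
have -> : mcoeff m q = 1.
  by case: (q01 m) => // qm; move: mq; rewrite mcoeff_msupp qm eqxx.
by rewrite mul1r; exact: monomial_on_cube.
Qed.

End PolynomialOnCube.

(** * Symmetrization of the Gaussian width *)

Section Symmetrization.
Context {R : realType}.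
Local Open Scope ereal_scope.

Lemma sume_cst (I : finType) (x : \bar R) :
  \sum_(i : I) x = #|I|%:R%:E * x.
Proof.
rewrite big_const; elim: #|_| => [|m IH]; first by rewrite mul0e.
by rewrite iterS IH -natr1 EFinD ge0_muleDl// mul1e addeC.
Qed.

Lemma integral_average_sign_flips k (H : k.-tuple (measurableTypeR R) -> \bar R) :
  measurable_fun setT H -> (forall g, 0 <= H g) ->
  \int[std_gaussian k]_g H g =
  \int[std_gaussian k]_g ((2 ^+ k)^-1%:E *
    \sum_(e : {ffun 'I_k -> bool}) H (sign_flip e g)).
Proof.
move=> mH H0.
have mHf (e : {ffun 'I_k -> bool}) : measurable_fun
    [set: k.-tuple (measurableTypeR R)] (fun g => H (sign_flip e g)).
  by apply: measurableT_comp => //; exact: measurable_sign_flip.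
have c0 : (0 <= (2 ^+ k)^-1 :> R)%R by rewrite invr_ge0 exprn_ge0.
rewrite ge0_integralZl//; last 2 first.
- exact: emeasurable_sum.
- by move=> g _; exact: sume_ge0.
rewrite ge0_integral_sum//.
under eq_bigr do rewrite std_gaussian_sign_flip//.
rewrite sume_cst card_ffun card_bool card_ord muleA -EFinM.
by rewrite natrX mulVf ?mul1e// expf_neq0.
Qed.

Lemma integral_affine_mean_square k (C a b : R) :
  (0 < k)%N -> (0 <= a)%R -> (0 <= b)%R ->
  \int[normal_prob 0 1]_x (x ^+ 2)%:E <= C%:E ->
  \int[std_gaussian k]_g (a * (b + k%:R^-1 * \sum_(i < k) tnth g i ^+ 2))%:E
    <= (a * (b + C))%:E.
Proof.
move=> k0 a0 b0 leC.
pose sq (i : 'I_k) (g : k.-tuple (measurableTypeR R)) := (tnth g i ^+ 2)%:E.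
have msq i : measurable_fun setT (sq i).
  by apply/measurable_EFinP/measurable_funX; exact: measurable_tnth.
have sq0 i g : 0 <= sq i g by rewrite lee_fin sqr_ge0.
have intsq i : \int[std_gaussian k]_g sq i g <= C%:E.
  rewrite (integral_coord_std_gaussian i (h := fun x => (x ^+ 2)%:E))//.
    by apply/measurable_EFinP; exact: measurable_funX.
  by move=> x; rewrite lee_fin sqr_ge0.
have kR0 : (0 < k%:R :> R)%R by rewrite ltr0n.
have kV0 : (0 <= k%:R^-1 :> R)%R by rewrite invr_ge0.
have msum : measurable_fun setT (fun g => \sum_(i < k) sq i g).
  exact: emeasurable_sum.
have sum0 g : 0 <= \sum_(i < k) sq i g by exact: sume_ge0.
rewrite (eq_integral (fun g => a%:E * (b%:E + k%:R^-1%:E * \sum_(i < k) sq i g))).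
  rewrite ge0_integralZl//; last 2 first.
  - by apply: emeasurable_funD => //; exact: measurable_funeM.
  - by move=> g _; rewrite adde_ge0// mule_ge0.
  rewrite ge0_integralD//; last 2 first.
  - by move=> g _; rewrite mule_ge0.
  - exact: measurable_funeM.
  rewrite integral_probability_cst ge0_integralZl// ge0_integral_sum//.
  rewrite EFinM lee_wpmul2l// EFinD leeD2l//.
  apply: (@le_trans _ _ (k%:R^-1%:E * \sum_(i < k) C%:E)).
    by rewrite lee_wpmul2l// lee_sum.
  rewrite sume_cst card_ord muleA -EFinM mulVf ?mul1r//.
  by rewrite gt_eqF.
by move=> g _; rewrite sumEFin -EFinM.
Qed.

Lemma measurable_bigmaxr (d : measure_display) (T : measurableType d)
    (I : Type) (l : seq I) (F : I -> T -> R) :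
  (forall i, measurable_fun setT (F i)) ->
  measurable_fun setT (fun x => \big[Num.max/0%R]_(i <- l) F i x).
Proof.
move=> mF; elim: l => [|i l IH].
  by under eq_fun do rewrite big_nil; exact: measurable_cst.
by under eq_fun do rewrite big_cons; exact: measurable_maxr.
Qed.

(** The maximum is taken with [0] because the integrals of nonnegative functions are
the ones that are transformed freely; replacing the supremum by its positive part
only increases its integral. *)
Lemma gaussian_width_le k (I : finType) (y : I -> 'rV[R]_k)
    (B : k.-tuple R -> R) :
  measurable_fun [set: k.-tuple (measurableTypeR R)] B ->
  (forall g, ((2 ^+ k)^-1 * \sum_(e : {ffun 'I_k -> bool})
    \big[Num.max/0]_i \sum_(j < k) y i ord0 j * tnth (sign_flip e g) j
      <= B g)%R) ->
  gaussian_width (range y) <= \int[std_gaussian k]_g (B g)%:E.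
Proof.
move=> mB avgB; rewrite /gaussian_width.
set f := fun g => ereal_sup _.
pose H (g : k.-tuple (measurableTypeR R)) : R :=
  \big[Num.max/0%R]_i (\sum_(j < k) y i ord0 j * tnth g j)%R.
have H0 g : (0 <= H g)%R by exact: bigmax_ge_id.
have mH : measurable_fun setT (fun g => (H g)%:E).
  apply/measurable_EFinP; apply: measurable_bigmaxr => i.
  apply: measurable_sum => j; apply: measurable_funM => //.
  exact: measurable_tnth.
have fpos g : f^\+ g = (H g)%:E.
  rewrite funeposE; apply/le_anti/andP; split.
    rewrite ge_max lee_fin H0 andbT; apply/ereal_supP => _ [_ [i _ <-] <-].
    by rewrite lee_fin; exact: (le_bigmax 0%R (fun i => \sum_(j < k) y i ord0 j * tnth g j)%R i).
  rewrite /H; elim/big_ind: _ => [|u v u_le v_le|i _].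
  - by rewrite le_max lexx orbT.
  - by rewrite EFin_max ge_max u_le v_le.
  - by rewrite le_max; apply/orP; left; apply: ereal_sup_ubound; exists (y i) => //; exists i.
rewrite integralE (@le_trans _ _ (\int[std_gaussian k]_g (f^\+ g)))//.
  by rewrite geeDl// oppe_le0; exact: integral_ge0.
under eq_integral do rewrite fpos.
rewrite [leLHS]integral_average_sign_flips//.
apply: ge0_le_integral => //.
- move=> g _; apply: mule_ge0; first by rewrite lee_fin invr_ge0 exprn_ge0.
  by apply: sume_ge0 => e _; rewrite lee_fin H0.
- apply: measurable_funeM; apply: emeasurable_sum => e.
  apply: (measurableT_comp mH); exact: measurable_sign_flip.
- exact/measurable_EFinP.
by move=> g _; rewrite sumEFin -EFinM lee_fin avgB.
Qed.

End Symmetrization.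

(** * Pointwise bound and conclusion *)

Section PointwiseBound.
Context {R : realType}.

Lemma prod_coord_form_norm_le1 (d n : nat) (r : 'I_d -> R) (s : 'I_d -> 'I_n) :
  (forall i, 0 < r i) -> mlform_norm r (prod_coord_form s) <= 1.
Proof.
move=> r0; apply: mlform_norm_le => // x; rewrite mul1r /= normr_prod.
by apply: ler_prod => i _; rewrite normr_ge0 coord_le_lnorm.
Qed.

Definition cube_point (n : nat) (b : {ffun 'I_n -> bool}) : 'rV[R]_n :=
  \row_j (b j)%:R.

Lemma cube_point01 (n : nat) (b : {ffun 'I_n -> bool}) : cube01 (cube_point b).
Proof. by move=> j; rewrite mxE; case: (b j); [right|left]. Qed.

Lemma cube01_range (n : nat) : cube01 = range (@cube_point n).
Proof.
apply/seteqP; split => [x x01|_ [b _ <-]]; last exact: cube_point01.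
exists [ffun j => x ord0 j == 1] => //; apply/rowP => j; rewrite mxE ffunE.
by case: (x01 j) => ->; rewrite ?eqxx// eq_sym oner_eq0.
Qed.

Lemma mlspace_linear_comb (d n k : nat) (r : 'I_d -> R) (r1 : forall i, 1 <= r i)
    (c : 'I_k -> R) (L : 'I_k -> mlspace n r1) x :
  (\sum_(i < k) c i *: L i : mlform R d n) x =
  \sum_(i < k) c i * (L i : mlform R d n) x.
Proof. by apply: (big_morph (fun M : mlform R d n => M x)). Qed.

(** For each sign pattern, the maximum is at most [n] times the sum of the norms of
the signed combinations [U] of the forms of the [psi i] and [V] of the forms carrying
their constant terms; the type inequality averages these norms. The factor
[(d * t).+1] is the bound [d * t] for the former plus [1] for the latter. *)
Lemma average_max_le (d n k t : nat) (psi : 'I_k -> mpoly n R)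
    (r : 'I_d -> R) (r1 : forall i, 1 <= r i) (p T : R)
    (g : k.-tuple R) :
  (0 < d)%N -> (0 < n)%N -> (0 < k)%N -> (0 < t)%N ->
  (forall i, coef01 (psi i)) -> (forall i, degree_le d (psi i)) ->
  (forall i, multiplicity_le t (psi i)) ->
  \sum_(i < d) (r i)^-1 = 1 -> 1 <= p -> p <= 2 ->
  0 <= T -> type_ineq (mlspace n r1) p T ->
  (2 ^+ k)^-1 * \sum_(e : {ffun 'I_k -> bool}) \big[Num.max/0]_(b : {ffun 'I_n -> bool})
      \sum_(i < k) poly_map psi (cube_point b) ord0 i * tnth (sign_flip e g) i
    <= n%:R * T * (d * t).+1%:R * k%:R `^ p^-1 *
       (2 + k%:R^-1 * \sum_(i < k) tnth g i ^+ 2).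
Proof.
move=> d0 n0 k0 t0 psi01 psid psit rsum p1 p2 T0 typeT.
have r0 i : 0 < r i by exact: lt_le_trans (r1 i).
have /boolp.choice[L LP] i := poly_on_cube_multilinear_form n0 r0 rsum
  (psi01 i) (psid i) (psit i).
pose Lam i : mlspace n r1 := L i.
pose M i : mlspace n r1 :=
  mcoeff mnm0 (psi i) *: (prod_coord_form (fun=> Ordinal n0) : mlspace n r1).
have normLam i : `|Lam i| <= (d * t)%:R by have [] := LP i.
have normM i : `|M i| <= 1.
  rewrite normrZ mulr_ile1//; last exact: prod_coord_form_norm_le1.
  by case: (psi01 i mnm0) => ->; rewrite ?normr0 ?normr1.
pose U (e : {ffun 'I_k -> bool}) := \sum_(i < k) (-1) ^+ e i *: (tnth g i *: Lam i).
pose V (e : {ffun 'I_k -> bool}) := \sum_(i < k) (-1) ^+ e i *: (tnth g i *: M i).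
have max_le (e : {ffun 'I_k -> bool}) :
    \big[Num.max/0]_(b : {ffun 'I_n -> bool})
      \sum_(i < k) poly_map psi (cube_point b) ord0 i * tnth (sign_flip e g) i
    <= n%:R * (`|U e| + `|V e|).
  apply: bigmax_le => [|b _]; first by rewrite mulr_ge0// addr_ge0.
  have one01 : cube01 (const_mx 1 : 'rV[R]_n) by move=> j; right; rewrite mxE.
  have leU := mlform_cube_le (U e) n0 r0 rsum (cube_point01 b).
  have leV := mlform_cube_le (V e) n0 r0 rsum one01.
  rewrite mulrDr (le_trans _ (lerD leU leV))//.
  apply: le_trans (lerD (ler_norm _) (ler_norm _)).
  rewrite /U /V.
  under [X in mlform_fun X _]eq_bigr do rewrite scalerA.
  under [X in _ + mlform_fun X _]eq_bigr do rewrite scalerA.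
  rewrite !mlspace_linear_comb -big_split le_eqVlt; apply/orP; left; apply/eqP.
  apply: eq_bigr => i _; rewrite tnth_mktuple mxE.
  have [_ ->] := LP i; last exact: cube_point01.
  have -> : (M i : mlform R d n) (fun=> const_mx 1) = mcoeff mnm0 (psi i).
    have -> : (M i : mlform R d n) (fun=> const_mx 1) =
      mcoeff mnm0 (psi i) * \prod_(j < d) (const_mx 1 : 'rV[R]_n) ord0 (Ordinal n0).
      by [].
    by rewrite big1 ?mulr1// => j _; rewrite mxE.
  by rewrite addrC mulrC mulrDr.
have avgU := type_ineq_weighted (tnth g) k0 p1 p2 T0 typeT _ normLam.
have avgV := type_ineq_weighted (tnth g) k0 p1 p2 T0 typeT ltr01 normM.
apply: (@le_trans _ _ (n%:R * ((2 ^+ k)^-1 * \sum_e `|U e| + (2 ^+ k)^-1 * \sum_e `|V e|))).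
  rewrite -mulrDr mulrCA ler_wpM2l ?invr_ge0 ?exprn_ge0//.
  by rewrite -big_split mulr_sumr ler_sum.
rewrite -!mulrA ler_wpM2l//.
apply: le_trans (lerD (avgU _) avgV) _; first by rewrite ltr0n muln_gt0 d0.
by rewrite le_eqVlt; apply/orP; left; apply/eqP; rewrite -natr1; ring.
Qed.

End PointwiseBound.

Theorem lemma1p5 (R : realType) (d : nat) (d_ge1 : (1 <= d)%N) :
  exists K : R, 0 < K /\
    forall (n k t : nat) (n_ge1 : (1 <= n)%N) (k_ge1 : (1 <= k)%N)
      (t_ge1 : (1 <= t)%N) (psi : 'I_k -> mpoly n R)
      (psi_multilinear : forall i, multilinear_poly (psi i))
      (psi_coef : forall i, coef01 (psi i))
      (psi_degree : forall i, degree_le d (psi i))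
      (psi_multiplicity : forall i, multiplicity_le t (psi i))
      (r : 'I_d -> R) (r_ge1 : forall i, 1 <= r i)
      (r_sum : \sum_(i < d) (r i)^-1 = 1)
      (p : R) (p_ge1 : 1 <= p) (p_le2 : p <= 2),
    (gaussian_width (poly_map psi @` cube01)
      <= (K * n%:R * t%:R)%:E * type_constant (mlspace n r_ge1) p
         * (k%:R `^ p^-1)%:E)%E.
Proof.
(* One factor d + 1 bounds (d t + 1) / t; the other is the mean of the affine function
   of type_ineq_weighted. *)
have [C C0 leC] := @normal_prob_second_moment R.
exists (d.+1%:R * (2 + C)); split; first by rewrite mulr_gt0// ltr_wpDr.
move=> n k t n_ge1 k_ge1 t_ge1 psi _ psi_coef psi_degree psi_multiplicity.
move=> r r_ge1 r_sum p p_ge1 p_le2.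
set K := d.+1%:R * (2 + C); set kp := k%:R `^ p^-1.
have kp0 : 0 < kp by apply: powR_gt0; rewrite ltr0n.
have K0 : 0 < K * n%:R * t%:R * kp.
  by rewrite !mulr_gt0 ?ltr0n// ltr_wpDr.
rewrite muleAC -EFinM -lee_pdivrMl//.
apply/ereal_infP => _ [T [T0 typeT] <-].
rewrite lee_pdivrMl// -EFinM.
rewrite cube01_range image_comp.
set a := n%:R * T * (d * t).+1%:R * kp.
have a0 : 0 <= a by rewrite !mulr_ge0// ltW.
apply: (@le_trans _ _ (\int[std_gaussian k]_g
    (a * (2 + k%:R^-1 * \sum_(i < k) tnth g i ^+ 2))%:E)%E).
  apply: (gaussian_width_le (B := fun g : k.-tuple R =>
    a * (2 + k%:R^-1 * \sum_(i < k) tnth g i ^+ 2))) => [|g]; last exact: average_max_le.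
  apply: measurable_funM => //; apply: measurable_funD => //.
  apply: measurable_funM => //; apply: measurable_sum => i.
  by apply: measurable_funX; exact: measurable_tnth.
apply: (le_trans (integral_affine_mean_square k_ge1 a0 _ leC)) => //.
rewrite lee_fin /a /K.
rewrite [leLHS](_ : _ = (n%:R * T * kp * (2 + C)) * (d * t).+1%:R); last by ring.
rewrite [leRHS](_ : _ = (n%:R * T * kp * (2 + C)) * (d.+1 * t)%:R); last first.
  by rewrite natrM; ring.
rewrite ler_wpM2l ?mulr_ge0 ?addr_ge0 ?(ltW kp0)// ler_nat mulSn -add1n.
by rewrite leq_add2r.
Qed.
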